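(* Let $n$ be a positive integer and let $\Theta=(\alpha,\beta,\gamma)\in\mathfrak{A}_n$. There exists a 1-1 correspondence (bijection) between the set $LS(\Theta)$ of Latin squares having $\Theta$ as an autotopism and the set $FS(\Theta)$ of feasible solutions of a combinatorial optimization problem whose set of constraints, in the variables $(x_{ijk})_{i,j,k\in[n]}$, is $$\sum_{i\in[n]}x_{ijk}=1\ \ \forall j,k\in[n];\qquad \sum_{j\in[n]}x_{ijk}=1\ \ \forall i,k\in[n];\qquad \sum_{k\in[n]}x_{ijk}=1\ \ \forall i,j\in[n];$$ $$x_{ijk}\in\{0,1\}\ \ \forall i,j,k\in[n];\qquad x_{ijk}=x_{\alpha(i)\beta(j)\gamma(k)}\ \ \forall i,j,k\in[n].$$
   Context: $[n]=\{1,\dots,n\}$ and $S_n$ is the group of permutations of $[n]$. A Latin square of order $n$ is an $n\times n$ array $L=(l_{i,j})$ with entries in $[n]$ such that each symbol occurs exactly once in each row and each column; it is identified with its set of triples $\{(i,j,l_{i,j}) : i,j\in[n]\}$. $LS(n)$ is the set of Latin squares of order $n$. For $\Theta=(\alpha,\beta,\gamma)\in S_n\times S_n\times S_n$ (an isotopism), $L^\Theta=\{(\alpha(i),\beta(j),\gamma(l_{i,j})) : i,j\in[n]\}$, which is again a Latin square. $\Theta$ is an autotopism of $L$ if $L^\Theta=L$. $\mathfrak{A}_n$ is the set of all $\Theta\in S_n\times S_n\times S_n$ that are autotopisms of at least one Latin square of order $n$, and $LS(\Theta)=\{L\in LS(n) : L^\Theta=L\}$. *)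

(* Defs.v *)
From HB Require Import structures.
From mathcomp Require Import all_boot all_order all_fingroup all_algebra.

Set Implicit Arguments.
Unset Strict Implicit.
Unset Printing Implicit Defensive.

Import GRing.Theory.

(* [n] is rendered as 'I_n = {0, ..., n - 1}. *)

Definition latin_square (n : nat) (L : 'M['I_n]_n) : bool :=
  [forall i : 'I_n, forall k : 'I_n, #|[set j : 'I_n | L i j == k]| == 1]
  && [forall j : 'I_n, forall k : 'I_n, #|[set i : 'I_n | L i j == k]| == 1].

Definition LS (n : nat) : {set 'M['I_n]_n} := [set L | latin_square L].

Definition triples (n : nat) (L : 'M['I_n]_n) : {set 'I_n * 'I_n * 'I_n} :=
  [set (i, j, L i j) | i : 'I_n, j : 'I_n].

Definition isotopism (n : nat) : finType := ('S_n * 'S_n * 'S_n)%type.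

(* L^Theta, as a set of triples *)
Definition isotope (n : nat) (Theta : isotopism n) (L : 'M['I_n]_n) :
    {set 'I_n * 'I_n * 'I_n} :=
  let: (alpha, beta, gamma) := Theta in
  [set (alpha i, beta j, gamma (L i j)) | i : 'I_n, j : 'I_n].

Definition autotopism (n : nat) (Theta : isotopism n) (L : 'M['I_n]_n) : bool :=
  isotope Theta L == triples L.

Definition LS_fixed (n : nat) (Theta : isotopism n) : {set 'M['I_n]_n} :=
  [set L in LS n | autotopism Theta L].

Definition autotopisms (n : nat) : {set isotopism n} :=
  [set Theta | [exists L in LS n, autotopism Theta L]].

(* The variables range over int, the last-but-one constraint making them
   binary; there are infinitely many candidate x, whence a predicate and not
   a {set _}. *)
Definition feasible (n : nat) (Theta : isotopism n) :
    {pred {ffun 'I_n * 'I_n * 'I_n -> int}} :=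
  let: (alpha, beta, gamma) := Theta in
  fun x => [&&
    [forall j : 'I_n, forall k : 'I_n, (\sum_(i < n) x (i, j, k) == 1)%R],
    [forall i : 'I_n, forall k : 'I_n, (\sum_(j < n) x (i, j, k) == 1)%R],
    [forall i : 'I_n, forall j : 'I_n, (\sum_(k < n) x (i, j, k) == 1)%R],
    [forall i : 'I_n, forall j : 'I_n, forall k : 'I_n,
       x (i, j, k) \in [:: 0%R; 1%R]]
  & [forall i : 'I_n, forall j : 'I_n, forall k : 'I_n,
       x (i, j, k) == x (alpha i, beta j, gamma k)]].

(* Main.v *)
(** A Latin square [L] corresponds to the indicator function of its set of
    triples.  The sums over [i] and over [j] being [1] express the column and
    row conditions on [L], the sums over [k] together with binarity express that
    each cell holds exactly one symbol, and invariance of the indicator under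
    [Theta] is invariance of the set of triples. *)

Require Import Defs.
From mathcomp Require Import all_boot all_order all_fingroup all_algebra.

Set Implicit Arguments.
Unset Strict Implicit.
Unset Printing Implicit Defensive.

Import GRing.Theory Num.Theory.

Lemma sum_indicator_eq1 (I : finType) (P : pred I) :
  (\sum_i (P i)%:R == 1 :> int)%R = (#|[set i | P i]| == 1).
Proof.
rewrite -natr_sum (eqr_nat _ _ 1) -sum1dep_card [in RHS]big_mkcond.
by congr (_ == _); apply: eq_bigr => i _; case: (P i).
Qed.

(** A cell occurs in only one triple of [L], so membership of an image triple in [triples L]
    determines its symbol. Conversely, every cell is the image of its preimage under [alpha] and
    [beta], which gives the inclusion of [triples L] in the isotope. *)
Lemma autotopismP (n : nat) (alpha beta gamma : 'S_n) (L : 'M['I_n]_n) :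
  reflect (forall i j, L (alpha i) (beta j) = gamma (L i j))
          (autotopism (alpha, beta, gamma) L).
Proof.
apply: (iffP eqP) => [eqL i j | eqL].
  have: (alpha i, beta j, gamma (L i j)) \in triples L.
    by rewrite -eqL; apply/imset2P; exists i j.
  by case/imset2P=> i' j' _ _ [-> -> ->].
apply/setP=> t; apply/imset2P/imset2P => -[i j _ _ ->].
  by exists (alpha i) (beta j); rewrite ?eqL.
by exists ((alpha^-1)%g i) ((beta^-1)%g j); rewrite // -eqL !permKV.
Qed.

Section Indicator.

Variable n : nat.

Definition indicator (L : 'M['I_n]_n) : {ffun 'I_n * 'I_n * 'I_n -> int} :=
  [ffun t => (L t.1.1 t.1.2 == t.2)%:R%R].

(* [i] is a junk value, taken only off the feasible set. *)
Definition square_of (x : {ffun 'I_n * 'I_n * 'I_n -> int}) : 'M['I_n]_n :=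
  (\matrix_(i, j) odflt i [pick k | x (i, j, k) == 1])%R.

Lemma indicatorK : cancel indicator square_of.
Proof.
move=> L; apply/matrixP=> i j; rewrite mxE.
case: pickP => [k | /(_ (L i j))]; rewrite ffunE /= ?eqxx //.
by case: (L i j =P k).
Qed.

(** Stated for an arbitrary matrix, so that it can be read in both directions: cell sums and
    binarity hold for every indicator, leaving the row, column and invariance conditions to
    match. *)
Lemma feasible_indicator (Theta : isotopism n) (L : 'M['I_n]_n) :
  (indicator L \in feasible Theta) = (L \in LS_fixed Theta).
Proof.
case: Theta => [[alpha beta] gamma]; rewrite !inE unfold_in /latin_square /=.
have cellP i j : (\sum_k indicator L (i, j, k) == 1)%R.
  under eq_bigr do rewrite ffunE /=.
  rewrite sum_indicator_eq1; apply/cards1P; exists (L i j).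
  by apply/setP=> k; rewrite !inE eq_sym.
have -> : [forall i, forall j, (\sum_k indicator L (i, j, k) == 1)%R].
  by apply/'forall_forallP.
have -> : [forall i, forall j, forall k,
    indicator L (i, j, k) \in [:: 0%R; 1%R]].
  apply/'forall_'forall_forallP => i j k.
  by rewrite ffunE /=; case: eqP.
have -> : [forall i, forall j, forall k,
    indicator L (i, j, k) == indicator L (alpha i, beta j, gamma k)]
    = autotopism (alpha, beta, gamma) L.
  apply/'forall_'forall_'forall_eqP/autotopismP => eqL i j.
    (* At [k = L i j] the left-hand indicator is 1, so the right-hand one must be 1 too. *)
    have:= eqL i j (L i j); rewrite !ffunE /= eqxx.
    by case: eqP.
  by move=> k; rewrite !ffunE /= eqL (inj_eq perm_inj).
(* [feasible] lists the column condition first, [latin_square] the row condition. *)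
rewrite /= andbA; congr (_ && _); rewrite andbC; congr (_ && _).
  apply: eq_forallb => i; apply: eq_forallb => k.
  by rewrite -sum_indicator_eq1; under eq_bigr do rewrite ffunE.
apply: eq_forallb => j; apply: eq_forallb => k.
by rewrite -sum_indicator_eq1; under eq_bigr do rewrite ffunE.
Qed.

(** By binarity each entry is the truth value of being 1; the cell sum then leaves exactly one [k]
    with value 1, which [pick] must return. *)
Lemma square_ofK (Theta : isotopism n) :
  {in feasible Theta, cancel square_of indicator}.
Proof.
case: Theta => [[alpha beta] gamma] x.
case/and5P=> _ _ /'forall_forallP cellP /'forall_'forall_forallP binP _.
have xE i j k : x (i, j, k) = (x (i, j, k) == 1%R)%:R%R.
  by have:= binP i j k; rewrite !inE => /orP[]/eqP->.
apply/ffunP=> -[[i j] k]; rewrite ffunE mxE /= xE.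
have := cellP i j; under eq_bigr do rewrite xE.
rewrite sum_indicator_eq1 => /cards1P[k0 /setP Dk0].
have {}Dk0 l : (x (i, j, l) == 1%R) = (l == k0) by have:= Dk0 l; rewrite !inE.
case: pickP => [l | /(_ k0)]; rewrite !Dk0 ?eqxx // => /eqP->.
by rewrite eq_sym.
Qed.

End Indicator.

Theorem theorem2p1 (n : nat) (hn : 0 < n) (alpha beta gamma : 'S_n)
    (hTheta : (alpha, beta, gamma) \in autotopisms n) :
  exists f : {L : 'M['I_n]_n | L \in LS_fixed (alpha, beta, gamma)} ->
             {x : {ffun 'I_n * 'I_n * 'I_n -> int} |
               x \in feasible (alpha, beta, gamma)},
    bijective f.
Proof.
have fP (L : {L | L \in LS_fixed (alpha, beta, gamma)}) :
    indicator (val L) \in feasible (alpha, beta, gamma).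
  by rewrite feasible_indicator (valP L).
have gP (x : {x | x \in feasible (alpha, beta, gamma)}) :
    square_of (val x) \in LS_fixed (alpha, beta, gamma).
  (* The square is Latin and fixed because its indicator is [x] itself, which is feasible. *)
  by rewrite -feasible_indicator (square_ofK (valP x)) (valP x).
exists (fun L => exist _ (indicator (val L)) (fP L)).
exists (fun x => exist _ (square_of (val x)) (gP x)) => [L | x]; apply: val_inj.
  exact: indicatorK.
exact: square_ofK (valP x).
Qed.
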